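(* Consider the controlled branching process of the context and suppose there are probability generating functions $l_L,l_U,d_L,d_U$ with $d_e(1)=l_e(1)=1$ for $e\in\{L,U\}$, $l_L'(1)=l_U'(1)=\tau\in(0,\infty)$, and $$d_L(s)l_L(s)^k\le h_k(s)\le d_U(s)l_U(s)^k,\qquad k\in\{0,1,2,\dots\},\ 0\le s\le1.$$ Put $u_e:=l_e\circ f$, $R_e:=d_e\circ f$ and define $F_0^e:=F_0$, $F_{n+1}^e(s):=R_e(s)F_n^e(u_e(s))$ for $e\in\{L,U\}$. Then for every $n\ge0$ and $s\in[0,1]$, $$F_n^L(s)\le F_n(s)\le F_n^U(s),\qquad d_L(s)F_n^L(l_L(s))\le H_n(s)\le d_U(s)F_n^U(l_U(s)).$$ Moreover, with $u_e^{(j)}$ the $j$-th iterate of $u_e$, $$F_n^e(s)=F_0(u_e^{(n)}(s))\prod_{j=0}^{n-1}R_e(u_e^{(j)}(s)),$$ and, with $H_n^e(s):=d_e(s)F_n^e(l_e(s))$, $$H_n^e(s)=d_e(s)\,F_0\bigl(u_e^{(n)}(l_e(s))\bigr)\prod_{j=0}^{n-1}R_e\bigl(u_e^{(j)}(l_e(s))\bigr).$$ Finally, $H_n^e(f(s))=F_{n+1}^e(s)$.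
   Context: Controlled branching process: $\xi_{n,j}$ are i.i.d. copies of a nonnegative integer-valued $\xi$ with mean in $(0,\infty)$ and probability generating function $f$; the random control functions $\phi_n:\{0,1,2,\dots\}\to\{0,1,2,\dots\}$ are i.i.d. copies of $\phi$, independent of the offspring array and of $X_0$; $N_n:=\phi_n(X_n)$ and $X_{n+1}:=\sum_{j=1}^{N_n}\xi_{n,j}$. Notation: $h_k(s):=\mathbf E[s^{\phi(k)}]$, $F_n(s):=\mathbf E[s^{X_n}]$, $H_n(s):=\mathbf E[s^{N_n}]$. *)

(* Defs.v *)
From mathcomp Require Import all_boot all_order all_algebra finmap.
From mathcomp Require Import all_classical all_reals all_analysis.

Set Implicit Arguments.
Unset Strict Implicit.
Unset Printing Implicit Defensive.

Import Order.TTheory GRing.Theory Num.Theory.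
Import numFieldNormedType.Exports.

Local Open Scope classical_set_scope.
Local Open Scope ring_scope.

(* The measurable space nat ^ nat of control functions, with the product
   sigma-algebra: a random variable in this space is a random function
   phi such that every phi k is a random variable. *)
Definition cylinders : set (set (nat -> nat)) :=
  [set C | exists (k : nat) (B : set nat), C = [set g | B (g k)]].

Definition control_fun := g_sigma_algebraType cylinders.

Section independence.
Context d (T : measurableType d) (R : realType) (P : probability T R).

Definition mutually_independent (I : choiceType) (F : I -> set (set T)) :=
  forall (J : {fset I}) (A : I -> set T),
    (forall i, i \in J -> F i (A i)) ->
    P (\bigcap_(i in [set` J]) A i) = (\prod_(i <- J) P (A i))%E.

Definition same_law d' (T' : measurableType d') (X Y : {RV P >-> T'}) :=
  forall A : set T', measurable A -> distribution P X A = distribution P Y A.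

End independence.

Section generating_functions.
Context (R : realType).

(* Only the values on [0, 1] are constrained. *)
Definition is_pgf (g : R -> R) :=
  exists p : nat -> R,
    [/\ forall k, 0 <= p k,
        series p @ \oo --> (1 : R)
      & forall s, 0 <= s <= 1 -> series (fun k => p k * s ^+ k) @ \oo --> g s].

Definition has_left_derivative (g : R -> R) (x a : R) :=
  (fun s => (g s - g x) / (s - x)) @ x^'- --> a.

Definition pgf d (T : measurableType d) (P : probability T R) (Y : T -> nat)
    (s : R) : R :=
  fine ('E_P[fun w => (s ^+ Y w)%R])%E.

Fixpoint bounding_pgf (F0 r u : R -> R) (n : nat) (s : R) : R :=
  if n is m.+1 then r s * bounding_pgf F0 r u m (u s)
  else F0 s.

End generating_functions.

Section controlled_branching_process.
Context d (T : measurableType d) (R : realType) (P : probability T R).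

(* Individuals of a generation are numbered from 0: [xi_ n j] is the offspring
   number of the individual j + 1 of the usual indexing from 1. *)
Fixpoint population (X0 : T -> nat) (xi_ : nat -> nat -> T -> nat)
    (phi_ : nat -> T -> nat -> nat) (n : nat) (w : T) : nat :=
  if n is m.+1 then
    (\sum_(j < phi_ m w (population X0 xi_ phi_ m w)) xi_ m j w)%N
  else X0 w.

Definition progenitors (X0 : T -> nat) (xi_ : nat -> nat -> T -> nat)
    (phi_ : nat -> T -> nat -> nat) (n : nat) (w : T) : nat :=
  phi_ n w (population X0 xi_ phi_ n w).

(* The sigma-algebras generated by X0 (index None), by each offspring variable
   and by each control function; for a fixed n, the variables phi_ n k may
   depend on one another. *)
Definition source_sigma_algebra (X0 : {RV P >-> nat})
    (xi_ : nat -> nat -> {RV P >-> nat}) (phi_ : nat -> {RV P >-> control_fun})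
    (i : option (nat * nat + nat)) : set (set T) :=
  match i with
  | None => g_sigma_algebra_preimage X0
  | Some (inl nj) => g_sigma_algebra_preimage (xi_ nj.1 nj.2)
  | Some (inr n) => g_sigma_algebra_preimage (phi_ n)
  end.

Definition is_cbp (xi : {RV P >-> nat}) (phi : {RV P >-> control_fun})
    (X0 : {RV P >-> nat}) (xi_ : nat -> nat -> {RV P >-> nat})
    (phi_ : nat -> {RV P >-> control_fun}) :=
  [/\ (0 < 'E_P[fun w => ((xi w)%:R : R)%R] < +oo)%E,
      forall n j, same_law (xi_ n j) xi,
      forall n, same_law (phi_ n) phi
    & mutually_independent P (source_sigma_algebra X0 xi_ phi_)].

End controlled_branching_process.

Variant side := Lower | Upper.

(* Main.v *)
(* Conditioning on the current generation gives
     H_n(s) = \sum_k P(X_n = k) h_k(s)   and   F_{n+1}(s) = H_n(f(s)),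
   so the bounds on h_k yield
     d_L(s) F_n(l_L(s)) <= H_n(s) <= d_U(s) F_n(l_U(s)),
   and composing with f makes an induction on n go through.  The independence
   needed for the two identities is that {X_n = k} and {N_n = m, S = a}, with S
   a partial offspring sum, are independent of every finite intersection of
   events of sources not used yet.  This property of an event survives
   countable disjoint unions and intersection with an event of a fresh source,
   so no monotone class argument is needed. *)
Require Import Defs.
From mathcomp Require Import all_boot all_order all_algebra finmap.
From mathcomp Require Import all_classical all_reals all_analysis.
From mathcomp Require Import measurable_realfun.

Set Implicit Arguments.
Unset Strict Implicit.
Unset Printing Implicit Defensive.

Import Order.TTheory GRing.Theory Num.Theory.
Import numFieldNormedType.Exports.

Local Open Scope classical_set_scope.
Local Open Scope ring_scope.

(** * Integrals of [s ^+ Y] over events, for integer-valued [Y] *)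

Section nat_variables.
Context d (T : measurableType d) (R : realType) (P : probability T R).
Local Open Scope ereal_scope.
Implicit Types (Y Z : T -> nat) (E : set T) (s : R).

(** The values are countable, so level sets suffice for measurability. Population sizes and
    progenitor numbers are plain functions, and the level-set form is what the independence lemmas
    deliver for them. *)
Definition measurable_levels Y := forall k, measurable (Y @^-1` [set k]).

Lemma measurable_levels_fun Y : measurable_levels Y -> measurable_fun setT Y.
Proof.
move=> mY _ B _; rewrite setTI.
rewrite (_ : _ @^-1` _ = \bigcup_(k in B) Y @^-1` [set k]).
  exact: bigcup_measurable.
by apply/seteqP; split=> [w Bw|w [k Bk /= ->]//]; exists (Y w).
Qed.

Lemma measurable_exprn_levels Y E s : measurable_levels Y ->
  measurable_fun E (fun w => (s ^+ Y w)%:E).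
Proof.
move=> mY; apply: (measurable_funS measurableT) => //.
apply/measurable_EFinP.
exact: (measurableT_comp (f := fun k : nat => (s ^+ k)%R) _
  (measurable_levels_fun mY)).
Qed.

Lemma integral_exprn_partition Y Z E s : measurable E -> (0 <= s)%R ->
  measurable_levels Y -> measurable_levels Z ->
  \int[P]_(w in E) (s ^+ Y w)%:E =
  \sum_(k <oo) \int[P]_(w in E `&` Z @^-1` [set k]) (s ^+ Y w)%:E.
Proof.
move=> mE s0 mY mZ.
have EE : E = \bigcup_k (E `&` Z @^-1` [set k]).
  apply/seteqP; split=> [w Ew|w [k _ []//]].
  by exists (Z w).
rewrite [in LHS]EE ge0_integral_bigcup //.
- by move=> k; exact: measurableI.
- exact: measurable_exprn_levels.
- by move=> w _; rewrite lee_fin exprn_ge0.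
- exact/trivIset_setIl/trivIset_preimage1.
Qed.

Lemma integral_exprn_shift Y Z E s k :
  (0 <= s)%R -> measurable E -> measurable_levels Z ->
  (forall w, E w -> Y w = (k + Z w)%N) ->
  \int[P]_(w in E) (s ^+ Y w)%:E =
  (s ^+ k)%:E * \int[P]_(w in E) (s ^+ Z w)%:E.
Proof.
move=> s0 mE mZ YE.
rewrite -ge0_integralZl_EFin//; last 3 first.
- by move=> w _; rewrite lee_fin exprn_ge0.
- exact: measurable_exprn_levels.
- exact: exprn_ge0.
by apply: eq_integral => w /set_mem Ew; rewrite -EFinM -exprD YE.
Qed.

Lemma integral_exprn_sum Y E s :
  measurable E -> (0 <= s)%R -> measurable_levels Y ->
  \int[P]_(w in E) (s ^+ Y w)%:E =
  \sum_(k <oo) (s ^+ k)%:E * P (E `&` Y @^-1` [set k]).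
Proof.
move=> mE s0 mY; rewrite (integral_exprn_partition mE s0 mY mY).
apply: eq_eseriesr => k _.
rewrite -integral_cst; last exact: measurableI.
by apply: eq_integral => w /set_mem[_ /= ->].
Qed.

Lemma integral_exprn_le1 Y s : measurable_levels Y -> (0 <= s <= 1)%R ->
  0 <= \int[P]_w (s ^+ Y w)%:E <= 1.
Proof.
move=> mY /andP[s0 s1].
rewrite integral_ge0/=; last by move=> w _; rewrite lee_fin exprn_ge0.
apply: (@le_trans _ _ (\int[P]_w (cst 1 w))); last first.
  by rewrite integral_cst// mul1e probability_le1.
apply: ge0_le_integral => //.
- by move=> w _; rewrite lee_fin exprn_ge0.
- exact: measurable_exprn_levels.
- by move=> w _; rewrite lee_fin exprn_ile1.
Qed.

Lemma pgfE Y s : measurable_levels Y -> (0 <= s <= 1)%R ->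
  \int[P]_w (s ^+ Y w)%:E = (pgf P Y s)%:E.
Proof.
move=> mY /(integral_exprn_le1 mY)/andP[I0 I1].
by rewrite /pgf unlock fineK// ge0_fin_numE// (le_lt_trans I1) ?ltry.
Qed.

Lemma pgf_itv Y s : measurable_levels Y -> (0 <= s <= 1)%R ->
  (0 <= pgf P Y s <= 1)%R.
Proof.
by move=> mY s01; rewrite -!lee_fin -(pgfE mY s01) integral_exprn_le1.
Qed.

(** Independence is needed only against the level sets of [Y], because both integrals are series in
    the probabilities of these levels. *)
Lemma integral_exprn_indep Y E s : measurable E -> (0 <= s <= 1)%R ->
  measurable_levels Y ->
  (forall k, P (E `&` Y @^-1` [set k]) = P E * P (Y @^-1` [set k])) ->
  \int[P]_(w in E) (s ^+ Y w)%:E = P E * (pgf P Y s)%:E.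
Proof.
move=> mE s01 mY EY; have /andP[s0 _] := s01.
rewrite -pgfE// !integral_exprn_sum//.
(* The probability is exhibited as a real constant so that it can be pulled out of the series. *)
have /fineK <- : P E \is a fin_num by exact: fin_num_measure.
rewrite -nneseriesZl; last first.
  by move=> k _; rewrite mule_ge0// lee_fin exprn_ge0.
apply: eq_eseriesr => k _.
by rewrite setTI EY fineK ?fin_num_measure// muleCA.
Qed.

(** On the slice where [Y] equals [a], the factor [s ^+ a] is constant and [Z] is independent of the
    slice; summing over [a] rebuilds the integral of [s ^+ Y] on [E]. *)
Lemma integral_exprn_addn Y Z E s : measurable E -> (0 <= s <= 1)%R ->
  measurable_levels Y -> measurable_levels Z ->
  (forall a b, P ((E `&` Y @^-1` [set a]) `&` Z @^-1` [set b]) =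
     P (E `&` Y @^-1` [set a]) * P (Z @^-1` [set b])) ->
  \int[P]_(w in E) (s ^+ (Y w + Z w)%N)%:E =
  \int[P]_(w in E) (s ^+ Y w)%:E * (pgf P Z s)%:E.
Proof.
move=> mE s01 mY mZ EYZ; have /andP[s0 _] := s01.
have mEY k : measurable (E `&` Y @^-1` [set k]) by exact: measurableI.
have mYZ : measurable_levels (fun w => (Y w + Z w)%N).
  move=> k; rewrite -[_ @^-1` _]setTI.
  by apply: measurable_fun_addn => //; exact: measurable_levels_fun.
rewrite (integral_exprn_partition mE s0 mYZ mY) (integral_exprn_sum mE s0 mY).
rewrite muleC -nneseriesZl; last first.
  by move=> k _; rewrite mule_ge0// lee_fin exprn_ge0.
apply: eq_eseriesr => k _.
rewrite (@integral_exprn_shift _ Z _ s k)//; last by move=> w [_ /= ->].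
by rewrite integral_exprn_indep// muleA muleC.
Qed.

End nat_variables.

Section independence.
Context d (T : measurableType d) (R : realType) (P : probability T R).
Local Open Scope ereal_scope.
Variables (I : choiceType) (F : I -> set (set T)).
Hypothesis Fmeas : forall i A, F i A -> measurable A.
Hypothesis Findep : mutually_independent P F.
Implicit Types (S : set I) (E : set T).

(** [S] is the set of sources already used. Membership of [E] in the sigma-algebra generated by [S]
    is not demanded, only the product rule against fresh sources. *)
Definition indep_outside S E := measurable E /\
  forall (J : {fset I}) (A : I -> set T),
    (forall i, i \in J -> ~ S i /\ F i (A i)) ->
    P (E `&` \bigcap_(i in [set` J]) A i) =
    P E * P (\bigcap_(i in [set` J]) A i).

Lemma indep_outsideS S S' E : S `<=` S' -> indep_outside S E ->
  indep_outside S' E.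
Proof.
move=> SS' [mE indE]; split=> // J A JA; apply: indE => i /JA[nS' FA].
by split=> // /SS'.
Qed.

Lemma indep_outsideT : indep_outside set0 setT.
Proof. by split=> // J A _; rewrite setTI probability_setT mul1e. Qed.

Lemma indep_outside0 S : indep_outside S set0.
Proof. by split=> // J A _; rewrite set0I measure0 mul0e. Qed.

Lemma indep_outside_source S E i B : indep_outside S E -> ~ S i -> F i B ->
  P (E `&` B) = P E * P B.
Proof.
move=> [_ /(_ [fset i]%fset (fun=> B))] + nSi FB.
rewrite set_fset1 bigcap_set1; apply.
by move=> j; rewrite inE => /eqP->.
Qed.

(** Adding [B] at index [i] to a family of fresh events gives a family that is still outside [S], so
    [E] splits off. Mutual independence of the sources then separates [B] from the rest. *)
Lemma indep_outside_setI S E i B : indep_outside S E -> ~ S i -> F i B ->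
  indep_outside (S `|` [set i]) (E `&` B).
Proof.
move=> indE nSi FB; have [mE iE] := indE.
split=> [|J A JA]; first exact: measurableI (Fmeas FB).
have iJ : i \notin J by apply/negP => /JA[]; rewrite /setU/= => /not_orP[].
pose A' j := if j == i then B else A j.
have A'i : A' i = B by rewrite /A' eqxx.
have A'J j : j \in J -> A' j = A j.
  by move=> jJ; rewrite /A'; case: eqP => // ji; rewrite -ji jJ in iJ.
have capA : \bigcap_(j in [set` (i |` J)%fset]) A' j =
    B `&` \bigcap_(j in [set` J]) A j.
  by rewrite bigcap_fsetU1 A'i; congr setI; apply: eq_bigcapr => j /A'J.
have FA' j : j \in (i |` J)%fset -> ~ S j /\ F j (A' j).
  rewrite !inE => /orP[/eqP->|jJ]; first by rewrite A'i.
  by rewrite A'J//; have [+ FA] := JA _ jJ => /not_orP[].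
rewrite -setIA -capA iE// (indep_outside_source indE nSi FB) -muleA.
congr (_ * _); rewrite (Findep (J := (i |` J)%fset)) ?(Findep (J := J)).
- rewrite big_fsetU1//= A'i; congr (_ * _).
  by rewrite !big_seq; apply: eq_bigr => j /A'J->.
- by move=> j /JA[].
- by move=> j /FA'[].
Qed.

(** For a fixed intersection of fresh events, both sides of the product rule are countably additive
    in [E]. *)
Lemma indep_outside_bigcup S (E : nat -> set T) : trivIset setT E ->
  (forall k, indep_outside S (E k)) -> indep_outside S (\bigcup_k E k).
Proof.
move=> tE indE; have mE k : measurable (E k) by have [] := indE k.
split=> [|J A JA]; first exact: bigcup_measurable.
have mC : measurable (\bigcap_(i in [set` J]) A i).
  apply: fin_bigcap_measurable => [|i /JA[_]]; first exact: finite_fset.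
  exact: Fmeas.
rewrite setI_bigcupl !measure_semi_bigcup//; first last.
- by apply: bigcup_measurable => k _; exact: measurableI.
- exact: trivIset_setIr.
- by move=> k; exact: measurableI.
  exact: bigcup_measurable.
rewrite muleC; have /fineK <- : P (\bigcap_(i in [set` J]) A i) \is a fin_num.
  exact: fin_num_measure.
rewrite -nneseriesZl//; apply: eq_eseriesr => k _.
have [_ iE] := indE k; apply: etrans (iE _ _ JA) _.
by rewrite muleC fineK// fin_num_measure.
Qed.

End independence.

(** * Independence along the process and the two conditioning identities *)

Section process.
Context d (T : measurableType d) (R : realType) (P : probability T R).
Variables (X0 : {RV P >-> nat}) (xi_ : nat -> nat -> {RV P >-> nat}).
Variable phi_ : nat -> {RV P >-> control_fun}.
Local Open Scope ereal_scope.

Let F := source_sigma_algebra X0 xi_ phi_.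
Hypothesis Findep : mutually_independent P F.

Let X n := population X0 (fun n j => xi_ n j) (fun n => phi_ n) n.
Let N n := progenitors X0 (fun n j => xi_ n j) (fun n => phi_ n) n.
(** The number of summands is deterministic here; on the event that [N n] equals [m], the next
    population [X n.+1] is [S n m]. *)
Let S n i w := (\sum_(j < i) xi_ n j w)%N.

Lemma measurable_eval (k m : nat) :
  measurable ([set g | g k = m] : set control_fun).
Proof.
by apply: (@sub_sigma_algebra _ setT cylinders); exists k, [set m].
Qed.

Lemma measurable_levels_RV (Y : {RV P >-> nat}) : measurable_levels Y.
Proof. by move=> k; exact: measurable_funPTI. Qed.

Lemma measurable_levels_eval (phi : {RV P >-> control_fun}) k :
  measurable_levels (fun w => phi w k).
Proof.
by move=> m; exact: measurable_funPTI (measurable_eval k m).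
Qed.

Lemma source_measurable i A : F i A -> measurable A.
Proof.
by case: i => [[nj|n]|] [B mB <-]; exact: measurable_funP.
Qed.

Lemma source_initial B : F None (X0 @^-1` B).
Proof. by exists B => //; rewrite setTI. Qed.

Lemma source_offspring n j B : F (Some (inl (n, j))) (xi_ n j @^-1` B).
Proof. by exists B => //; rewrite setTI. Qed.

Lemma source_control n k m :
  F (Some (inr n)) ((fun w => phi_ n w k) @^-1` [set m]).
Proof.
exists [set g : control_fun | g k = m]; first exact: measurable_eval.
by rewrite setTI.
Qed.

(* The sources used up to the point of generation [n] at which the control
   function has been applied (if [b]) and [i] individuals have reproduced. *)
Definition history n (b : bool) i : set (option (nat * nat + nat)) :=
  fun x => match x with
  | None => True
  | Some (inl (m, j)) => (m < n)%N || (m == n) && (j < i)%N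
  | Some (inr m) => (m < n + b)%N
  end.

Lemma history_control n : history n false 0 `|` [set Some (inr n)]
  `<=` history n true 0.
Proof.
move=> [[[m j]|m]|] [|] //=; first by rewrite addn0 addn1 => /ltnW.
by move=> [->]; rewrite addn1.
Qed.

Lemma history_offspring n i : history n true i `|` [set Some (inl (n, i))]
  `<=` history n true i.+1.
Proof.
move=> [[[m j]|m]|] [|] //=.
  by move=> /orP[->//|/andP[-> ji]]; rewrite ltnS (ltnW ji) orbT.
by move=> [-> ->]; rewrite eqxx ltnSn orbT.
Qed.

(** The bound is uniform in [i]: events that have used different numbers of offspring variables get
    a common history, so they can be united over the values of [N n]. *)
Lemma history_next n i : history n true i `<=` history n.+1 false 0.
Proof.
move=> [[[m j]|m]|] //=; last by rewrite addn0 addn1.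
by move=> /orP[mn|/andP[/eqP-> _]]; rewrite ltnS ?leqnn// ltnW.
Qed.

(** Where [X n] equals [k], [N n] is the fresh variable [phi_ n] evaluated at the fixed point [k].
    The premise on [X n] is kept explicit because this is a step of the induction in
    [indep_population]. *)
Lemma indep_progenitors_of n :
  (forall k, indep_outside P F (history n false 0) (X n @^-1` [set k])) ->
  forall m, indep_outside P F (history n true 0) (N n @^-1` [set m]).
Proof.
move=> Xn m.
rewrite (_ : N n @^-1` _ = \bigcup_k (X n @^-1` [set k] `&`
    (fun w => phi_ n w k) @^-1` [set m])); last first.
  by apply/seteqP; split=> [w Nw|w [k _ [/= <-]]//]; exists (X n w).
apply: indep_outside_bigcup => [||k].
- exact: source_measurable.
- exact/trivIset_setIr/trivIset_preimage1.
- apply: (indep_outsideS (@history_control n)).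
  apply: indep_outside_setI => //; [exact: source_measurable| |].
    by rewrite /= addn0 ltnn.
  exact: source_control.
Qed.

(** Offspring variables are revealed one at a time; each is fresh for the event describing the
    previous partial sum. *)
Lemma indep_offspring_of n m :
  indep_outside P F (history n true 0) (N n @^-1` [set m]) ->
  forall i k, indep_outside P F (history n true i)
    (N n @^-1` [set m] `&` S n i @^-1` [set k]).
Proof.
move=> Nm; elim=> [|i IH] k.
  (* The empty sum is 0, so its level set is the whole space or empty. *)
  have [->|k0] := eqVneq k 0%N.
    rewrite (_ : S n 0 @^-1` _ = setT) ?setIT//.
    by apply/seteqP; split=> // w _; rewrite /S/= big_ord0.
  rewrite (_ : S n 0 @^-1` _ = set0).
    by rewrite setI0; exact: indep_outside0.
  apply/seteqP; split=> // w; rewrite /S/= big_ord0 => k0'.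
  by rewrite -k0' in k0.
(* Split by the value [a] of the sum before individual [i]; the rest is an event of [xi_ n i]
   alone. *)
rewrite (_ : _ `&` _ = \bigcup_a ((N n @^-1` [set m] `&` S n i @^-1` [set a])
    `&` xi_ n i @^-1` [set b | (a + b = k)%N])); last first.
  apply/seteqP; split=> [w [Nw]|w [a _ [[Nw /= <-]]]].
    by rewrite /S/= big_ord_recr/= => Sk; exists (S n i w).
  by move=> ab; split=> //; rewrite /S/= big_ord_recr.
apply: indep_outside_bigcup => [||a].
- exact: source_measurable.
- exact/trivIset_setIr/trivIset_setIl/trivIset_preimage1.
- apply: (indep_outsideS (@history_offspring n i)).
  apply: indep_outside_setI => //; [exact: source_measurable| |].
    by rewrite /= !ltnn andbF.
  exact: source_offspring.
Qed.

(** Induction over generations: condition on [N n] being [m], reveal [m] offspring variables, and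
    unite over [m]. *)
Lemma indep_population n k :
  indep_outside P F (history n false 0) (X n @^-1` [set k]).
Proof.
elim: n k => [|n IH] k.
  rewrite -[_ @^-1` _]setTI.
  apply: (@indep_outsideS _ _ _ _ _ _ (set0 `|` [set None])).
    by move=> x [//|/= ->].
  apply: indep_outside_setI => //; first exact: source_measurable.
    exact: indep_outsideT.
  exact: source_initial.
rewrite (_ : X n.+1 @^-1` _ = \bigcup_m (N n @^-1` [set m] `&`
    S n m @^-1` [set k])); last first.
  by apply/seteqP; split=> [w Xw|w [m _ [/= <-]]//]; exists (N n w).
apply: indep_outside_bigcup => [||m].
- exact: source_measurable.
- exact/trivIset_setIr/trivIset_preimage1.
- apply: (indep_outsideS (@history_next n m)).
  exact/indep_offspring_of/indep_progenitors_of.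
Qed.

Lemma indep_progenitors n m :
  indep_outside P F (history n true 0) (N n @^-1` [set m]).
Proof. exact/indep_progenitors_of/indep_population. Qed.

Lemma measurable_levels_population n : measurable_levels (X n).
Proof. by move=> k; have [] := indep_population n k. Qed.

Lemma measurable_levels_progenitors n : measurable_levels (N n).
Proof. by move=> k; have [] := indep_progenitors n k. Qed.

Lemma measurable_levels_offspring_sum n i : measurable_levels (S n i).
Proof.
suff mS : measurable_fun setT (S n i).
  by move=> k; rewrite -[_ @^-1` _]setTI; exact: mS.
rewrite /S; elim: i => [|i IH].
  apply: (eq_measurable_fun (cst 0%N)) => [w _|]; first by rewrite big_ord0.
  exact: measurable_cst.
pose SD w := ((\sum_(j < i) xi_ n j w) + xi_ n i w)%N.
apply: (eq_measurable_fun SD) => [w _|]; first by rewrite big_ord_recr.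
by apply: measurable_fun_addn => //; exact: measurable_funPT.
Qed.

(** On each level of [X n] the exponent is [phi_ n] at a fixed argument, independent of that
    level. *)
Lemma pgf_progenitors n s : (0 <= s <= 1)%R ->
  (pgf P (N n) s)%:E =
  \sum_(k <oo) P (X n @^-1` [set k]) * (pgf P (fun w => phi_ n w k) s)%:E.
Proof.
move=> s01; have /andP[s0 _] := s01.
rewrite -pgfE//; last exact: measurable_levels_progenitors.
rewrite (integral_exprn_partition P measurableT s0
  (@measurable_levels_progenitors n) (@measurable_levels_population n))//.
apply: eq_eseriesr => k _; rewrite setTI -integral_exprn_indep//.
- by apply: eq_integral => w /set_mem /= <-.
- exact: (@measurable_levels_population n k).
- exact: measurable_levels_eval.
- move=> m; apply: (indep_outside_source (indep_population n k) _
    (@source_control n k m)).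
  by rewrite /= addn0 ltnn.
Qed.

(** Each further individual contributes a factor [g], its offspring variable being independent of
    [N n] and the earlier partial sum jointly. *)
Lemma integral_exprn_offspring n m i s (g : R) : (0 <= s <= 1)%R ->
  (forall j, pgf P (xi_ n j) s = g) ->
  \int[P]_(w in N n @^-1` [set m]) (s ^+ S n i w)%:E =
  P (N n @^-1` [set m]) * (g ^+ i)%:E.
Proof.
move=> s01 xig; have mN := @measurable_levels_progenitors n m.
elim: i => [|i IH].
  rewrite expr0 mule1 -[RHS]mul1e -integral_cst//.
  by apply: eq_integral => w _; rewrite /S big_ord0 expr0.
rewrite exprSr EFinM muleA -IH -(xig i).
rewrite -integral_exprn_addn//.
- by apply: eq_integral => w _; rewrite /S big_ord_recr.
- exact: measurable_levels_offspring_sum.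
- exact: measurable_levels_RV.
- move=> a b; have := indep_offspring_of (indep_progenitors n m) i a.
  move=> /indep_outside_source; apply; last exact: source_offspring.
  by rewrite /= !ltnn andbF.
Qed.

(** The level [m] of [N n] contributes its probability times [g ^+ m], and these terms sum to the
    generating function of [N n] at [g]. *)
Lemma pgf_population n s (g : R) : (0 <= s <= 1)%R ->
  (forall j, pgf P (xi_ n j) s = g) ->
  pgf P (X n.+1) s = pgf P (N n) g.
Proof.
move=> s01 xig; have /andP[s0 _] := s01.
have g01 : (0 <= g <= 1)%R.
  by rewrite -(xig 0%N) pgf_itv//; exact: measurable_levels_RV.
have /andP[g0 _] := g01.
apply: EFin_inj; rewrite -!pgfE//; first last.
- exact: measurable_levels_population.
- exact: measurable_levels_progenitors.
rewrite (integral_exprn_partition P measurableT s0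
  (@measurable_levels_population n.+1) (@measurable_levels_progenitors n))//
  integral_exprn_sum//.
  apply: eq_eseriesr => m _; rewrite setTI muleC.
  rewrite -(integral_exprn_offspring _ _ s01 xig).
  by apply: eq_integral => w /set_mem /= <-.
exact: measurable_levels_progenitors.
Qed.

End process.

(** * Comparison of generating functions and the proof of the theorem *)

Lemma pgf_same_law d (T : measurableType d) (R : realType) (P : probability T R)
    (Y Z : T -> nat) (s : R) :
  0 <= s -> measurable_levels Y -> measurable_levels Z ->
  (forall k, P (Y @^-1` [set k]) = P (Z @^-1` [set k])) ->
  pgf P Y s = pgf P Z s.
Proof.
move=> s0 mY mZ YZ; rewrite /pgf unlock !integral_exprn_sum//.
by congr fine; apply: eq_eseriesr => k _; rewrite !setTI YZ.
Qed.

(** The upper bound compares partial sums termwise with those of the weights, which converge to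
    1. *)
Lemma is_pgf_itv (R : realType) (g : R -> R) s :
  is_pgf g -> 0 <= s <= 1 -> 0 <= g s <= 1.
Proof.
move=> [p [p0 p1 pg]] s01; have /andP[s0 s1] := s01; have gs := pg _ s01.
apply/andP; split.
  apply: (cvgr_to_ge gs); apply: nearW => n.
  by apply: sumr_ge0 => k _; rewrite mulr_ge0// exprn_ge0.
apply: (ler_cvg_to gs p1); apply: nearW => n.
by apply: ler_sum => k _; rewrite ler_piMr// exprn_ile1.
Qed.

Theorem proposition5p1 (dT : measure_display) (T : measurableType dT)
    (R : realType) (P : probability T R)
    (xi : {RV P >-> nat}) (phi : {RV P >-> control_fun})
    (X0 : {RV P >-> nat}) (xi_ : nat -> nat -> {RV P >-> nat})
    (phi_ : nat -> {RV P >-> control_fun})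
    (hcbp : is_cbp xi phi X0 xi_ phi_)
    (l d : side -> R -> R) (tau : R)
    (hl : forall e, is_pgf (l e)) (hd : forall e, is_pgf (d e))
    (hd1 : forall e, d e 1 = 1) (hl1 : forall e, l e 1 = 1)
    (htau : 0 < tau) (hl' : forall e, has_left_derivative (l e) 1 tau) :
  let X n := population X0 (fun n j => xi_ n j) (fun n => phi_ n) n in
  let N n := progenitors X0 (fun n j => xi_ n j) (fun n => phi_ n) n in
  let f := pgf P xi in
  let h k := pgf P (fun w => phi w k) in
  let F n := pgf P (X n) in
  let H n := pgf P (N n) in
  let u e := l e \o f in
  let r e := d e \o f in
  let Fb e := bounding_pgf (F 0%N) (r e) (u e) in
  let Hb e n s := d e s * Fb e n (l e s) in
  (forall (k : nat) (s : R), 0 <= s <= 1 ->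
     d Lower s * l Lower s ^+ k <= h k s <= d Upper s * l Upper s ^+ k) ->
  forall (n : nat) (s : R), 0 <= s <= 1 ->
    [/\ Fb Lower n s <= F n s <= Fb Upper n s,
        d Lower s * Fb Lower n (l Lower s) <= H n s
          <= d Upper s * Fb Upper n (l Upper s)
      & forall e : side,
          [/\ Fb e n s = F 0%N (iter n (u e) s)
                * \prod_(0 <= j < n) r e (iter j (u e) s),
              Hb e n s = d e s * F 0%N (iter n (u e) (l e s))
                * \prod_(0 <= j < n) r e (iter j (u e) (l e s))
            & Hb e n (f s) = Fb e n.+1 s]].
Proof.
move=> X N f h F H u r Fb Hb hlu.
have [_ xi_law phi_law indep] := hcbp.
have hk n k s : 0 <= s <= 1 -> pgf P (fun w => phi_ n w k) s = h k s.
  move=> /andP[s0 _]; apply: pgf_same_law => // [||m].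
  - exact: measurable_levels_eval.
  - exact: measurable_levels_eval.
  - exact: phi_law (measurable_eval k m).
have fE n j s : 0 <= s <= 1 -> pgf P (xi_ n j) s = f s.
  move=> /andP[s0 _]; apply: pgf_same_law => // [||m].
  - exact: measurable_levels_RV.
  - exact: measurable_levels_RV.
  - exact: xi_law.
have f01 s : 0 <= s <= 1 -> 0 <= f s <= 1.
  by apply: pgf_itv; exact: measurable_levels_RV.
have l01 e s : 0 <= s <= 1 -> 0 <= l e s <= 1 by exact: is_pgf_itv.
have d0 e s : 0 <= s <= 1 -> 0 <= d e s by move=> /(is_pgf_itv (hd e))/andP[].
have u01 e s : 0 <= s <= 1 -> 0 <= u e s <= 1 by move=> s01; exact/l01/f01.
have FS n s : 0 <= s <= 1 -> F n.+1 s = H n (f s).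
  by move=> s01; apply: pgf_population => // j; exact: fE.
have HF n s : 0 <= s <= 1 ->
    d Lower s * F n (l Lower s) <= H n s <= d Upper s * F n (l Upper s).
  move=> s01.
  (* Both bounds become the series of [pgf_progenitors] with [h k s] replaced by its bound, so the
     comparison is termwise. *)
  have dF e : (d e s * F n (l e s))%:E =
      (\sum_(k <oo) P (X n @^-1` [set k]) * (d e s * l e s ^+ k)%:E)%E.
    have mX := measurable_levels_population indep n.
    have /andP[le0 _] := l01 e _ s01.
    rewrite EFinM -(pgfE P mX) ?l01// integral_exprn_sum// -nneseriesZl.
      apply: eq_eseriesr => k _.
      by rewrite setTI EFinM muleA muleC.
    by move=> k _; rewrite mule_ge0// lee_fin exprn_ge0.
  have HE := pgf_progenitors indep n s01.
  rewrite -!lee_fin !dF HE; apply/andP; split; apply: lee_nneseries => k _.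
  - have /andP[le0 _] := l01 Lower _ s01.
    by move=> _; rewrite mule_ge0// lee_fin mulr_ge0 ?d0// exprn_ge0.
  - by rewrite lee_wpmul2l// lee_fin hk//; case/andP: (hlu k s s01).
  - move=> _; rewrite mule_ge0// lee_fin.
    by have /andP[] := pgf_itv P (measurable_levels_eval (phi_ n) k) s01.
  - by rewrite lee_wpmul2l// lee_fin hk//; case/andP: (hlu k s s01).
have FF n s : 0 <= s <= 1 -> Fb Lower n s <= F n s <= Fb Upper n s.
  elim: n s => [|n IH] s s01; first by rewrite /= !lexx.
  rewrite FS//= /r/=.
  (* At [f s], the bounds on [H n] involve [F n] at [l e (f s)], that is at [u e s], where the
     induction hypothesis applies. *)
  have /andP[HL HU] := HF n _ (f01 _ s01).
  have fs := f01 _ s01.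
  apply/andP; split.
    apply: le_trans HL; rewrite ler_wpM2l ?d0//.
    by have /andP[] := IH _ (u01 Lower _ s01).
  apply: (le_trans HU); rewrite ler_wpM2l ?d0//.
  by have /andP[] := IH _ (u01 Upper _ s01).
have FbE e n s : Fb e n s = F 0%N (iter n (u e) s)
    * \prod_(0 <= j < n) r e (iter j (u e) s).
  elim: n s => [|n IH] s; first by rewrite big_nil mulr1.
  (* The recursion shifts the starting point to [u e s]: iterates from there are those from [s] with
     one more step, and [r e s] is the missing factor of index 0. *)
  rewrite -[LHS]/(r e s * Fb e n (u e s)) IH -iterSr big_nat_recl// mulrCA.
  by under eq_bigr do rewrite -iterSr.
move=> n s s01; split; first exact: FF.
  have /andP[HL HU] := HF n _ s01.
  apply/andP; split.
    apply: le_trans HL; rewrite ler_wpM2l ?d0//.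
    by have /andP[] := FF n _ (l01 Lower _ s01).
  apply: (le_trans HU); rewrite ler_wpM2l ?d0//.
  by have /andP[] := FF n _ (l01 Upper _ s01).
(* The identity for [Hb] at [f s] holds by conversion, as [r e s] and [u e s] unfold to [d e (f s)]
   and [l e (f s)]. *)
by move=> e; split=> //; rewrite /Hb FbE mulrA.
Qed.
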